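(* Let $n \geq 4$ be an even integer and let $\widetilde{L}$ be the special Laplacian of the wheel graph $W_n$. Then $\widetilde{L}$ is positive semidefinite.
   Context: For $c=(c_1,\dotsc,c_m)$, $\mathrm{Circ}(c)$ denotes the $m\times m$ circulant matrix whose $(i,j)$ entry is $c_{((j-i) \bmod m)+1}$. Special Laplacian: for $n\ge4$ even and $k\in\{1,\dotsc,\frac n2-1\}$, let $c^k\in\mathbb{R}^{n-1}$ have $c^k_j=1$ if $j=k+1$ or $j=n-k$ and $c^k_j=0$ otherwise, and let $C_k=\mathrm{Circ}(c^k)$ (of order $n-1$). Then \[\widetilde{L} := \frac{n-1}{2} I - \frac12\begin{bmatrix}0 & \mathbf{1}'\\ \mathbf{1} & 0\end{bmatrix} + \sum_{k=1}^{\frac n2 -1} (-1)^k \frac{(n-1)-2k}{2}\begin{bmatrix}0&0\\0&C_k\end{bmatrix},\] an $n\times n$ matrix, where $\mathbf{1}$ is the all-ones vector of length $n-1$. *)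

(* Defs.v *)
From HB Require Import structures.
From mathcomp Require Import all_boot all_order all_algebra.
From mathcomp Require Import reals.

Set Implicit Arguments.
Unset Strict Implicit.
Unset Printing Implicit Defensive.

Import Order.TTheory GRing.Theory Num.Theory.
Local Open Scope ring_scope.

Lemma circ_index_subproof (m : nat) (i j : 'I_m) : ((j + (m - i)) %% m < m)%N.
Proof. by rewrite ltn_mod (leq_ltn_trans (leq0n i) (ltn_ord i)). Qed.

(* The index [(j - i) mod m], written without truncated subtraction. *)
Definition circ_index (m : nat) (i j : 'I_m) : 'I_m :=
  Ordinal (circ_index_subproof i j).

(* Rows, columns and the entries of [c] are numbered from 0, so the shift by 1
   in [c_{((j - i) mod m) + 1}] disappears. *)
Definition Circ (R : realType) (m : nat) (c : 'rV[R]_m) : 'M[R]_m :=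
  \matrix_(i, j) c 0 (circ_index i j).

(* The 0-based column [j] is the entry number [j.+1] of the vector [c^k]. *)
Definition cvec (R : realType) (n k : nat) : 'rV[R]_(n.-1) :=
  \row_(j < n.-1) ((j.+1 == k + 1)%N || (j.+1 == n - k)%N)%:R.

Definition Cmx (R : realType) (n k : nat) : 'M[R]_(n.-1) := Circ (cvec R n k).

(* The order [1 + n.-1] equals [n] for [n > 0]; it exposes the block structure. *)
Definition special_laplacian (R : realType) (n : nat) : 'M[R]_(1 + n.-1) :=
  ((n%:R - 1) / 2) *: 1%:M
  - (1 / 2) *: block_mx (0 : 'M[R]_1) (const_mx 1) (const_mx 1) (0 : 'M[R]_(n.-1))
  + \sum_(1 <= k < n./2)
      ((-1) ^+ k * (((n%:R - 1) - 2 * k%:R) / 2)) *: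
        block_mx (0 : 'M[R]_1) 0 0 (Cmx R n k).

Definition positive_semidefinite (R : realType) (m : nat) (A : 'M[R]_m) : Prop :=
  A^T = A /\ forall x : 'cV[R]_m, 0 <= (x^T *m A *m x) 0 0.

(* Main.v *)
Require Import Defs.
From mathcomp Require Import all_boot all_order all_algebra.
From mathcomp Require Import reals.
From mathcomp Require Import zify ring.

Import Order.TTheory GRing.Theory Num.Theory.
Local Open Scope ring_scope.

(** Put [m = n - 1], which is odd.  The entries of the circulant block at
    positions [i], [j] equal [(-1)^(i+j) (m - 2|i-j|) / 2]: oddness of [m] makes
    the wrap-around invisible.  Now [m - 2|i-j|] is the inner product of the sign
    vectors [v_i, v_j] in [{1,-1}^m], where [v_i] has [i] leading ones followed by
    minus ones, and the alternating vector [w = (1,-1,1,...)] satisfies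
    [<w,w> = m] and [<w, v_i> = -(-1)^i].  Hence twice the special Laplacian is
    the Gram matrix of [w, v_0, -v_1, v_2, ...]. *)

Definition sign_vectors (R : realType) (m : nat) : 'M[R]_(m, 1 + m) :=
  row_mx (\matrix_(t, _) (-1) ^+ t) (\matrix_(t, i) ((-1) ^+ i * (-1) ^+ (i <= t)%N)).

(** The factors disagree exactly for [i <= t < j], and each disagreement costs 2. Capping [i] and
    [j] at [m] keeps the formula valid at every stage of the induction on [m]. *)
Lemma sum_step_signs (R : realType) (m i j : nat) : (i <= j)%N ->
  \sum_(t < m) (-1) ^+ (i <= t)%N * (-1) ^+ (j <= t)%N
  = m%:R - 2 * (minn j m)%:R + 2 * (minn i m)%:R :> R.
Proof.
move=> ij; elim: m => [|m IHm]; first by rewrite big_ord0 !minn0; ring.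
rewrite big_ord_recr /= IHm -!natr1.
case: (leqP i m) => im; case: (leqP j m) => jm; last 1 first.
- by rewrite !(minn_idPr _) // -natr1; ring.
- by rewrite !(minn_idPl (leqW _)) //; ring.
- by rewrite (minn_idPr jm) (minn_idPl (leqW im)) -natr1; ring.
- by lia.
Qed.

(** Twice the alternating sum up to [minn j m], minus the full alternating sum. For odd [m] and
    [j <= m] this is [- (-1) ^+ j]. *)
Lemma sum_step_alternating (R : realType) (m j : nat) :
  \sum_(t < m) (-1) ^+ t * (-1) ^+ (j <= t)%N
  = (1 - (-1) ^+ minn j m) - (1 - (-1) ^+ m) / 2 :> R.
Proof.
elim: m => [|m IHm]; first by rewrite big_ord0 minn0 !expr0; field.
rewrite big_ord_recr /= IHm exprS.
case: (leqP j m) => jm.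
- by rewrite (minn_idPl (leqW jm)); field.
- by rewrite (minn_idPr jm) exprS; field.
Qed.

Lemma odd_signr (R : realType) (m : nat) : odd m -> (-1) ^+ m = -1 :> R.
Proof. by move=> om; rewrite -signr_odd om. Qed.

(** At cyclic offset [d > 0] only [k = d] or [k = n.-1 - d] can contribute, and as [n.-1] is odd
    exactly one of them lies in the range of summation. Both would give the same coefficient. *)
Lemma sum_circulant_coef (R : realType) (n d : nat) :
  ~~ odd n -> (d < n.-1)%N ->
  (n%:R - 1) / 2 * (d == 0)%N%:R
  + \sum_(1 <= k < n./2) ((-1) ^+ k * (((n%:R - 1) - 2 * k%:R) / 2))
       * ((d.+1 == k + 1)%N || (d.+1 == n - k)%N)%:R
  = (-1) ^+ d * (n%:R - 1 - 2 * d%:R) / 2 :> R.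
Proof.
move=> en dn; have [->|d0] := posnP d.
  rewrite big1_seq => [|k]; first by rewrite expr0 /=; field.
  rewrite mem_index_iota => /andP[_ kn].
  have -> : (1 == k + 1)%N || (1 == n - k)%N = false by lia.
  by rewrite mulr0.
rewrite /= mulr0 add0r.
pose k0 := if (d < n./2)%N then d else (n.-1 - d)%N.
have k0n : k0 \in index_iota 1 n./2.
  by rewrite mem_index_iota /k0; case: ifP => ?; lia.
rewrite (bigD1_seq k0) ?iota_uniq //= big1_seq ?addr0 => [|k]; last first.
  rewrite mem_index_iota => /andP[kk0 kn].
  have -> : (d.+1 == k + 1)%N || (d.+1 == n - k)%N = false.
    by move: kk0; rewrite /k0; case: ifP => ?; lia.
  by rewrite mulr0.
have -> : (d.+1 == k0 + 1)%N || (d.+1 == n - k0)%N.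
  by rewrite /k0; case: ifP => ?; lia.
rewrite mulr1 /k0; case: ifP => dk; first by field.
have nE : n%:R = d%:R + (n.-1 - d)%:R + 1 :> R.
  by rewrite -natrD natr1; congr (_%:R); lia.
(* This sign change cancels the one in [n.-1 - 2 * k0 = - (n.-1 - 2 * d)]. *)
have -> : (-1) ^+ (n.-1 - d) = - (-1) ^+ d :> R.
  rewrite -[LHS]signr_odd -[in RHS]signr_odd.
  have -> : odd (n.-1 - d) = ~~ odd d by lia.
  by case: (odd d); rewrite /= ?expr0 ?expr1 ?opprK.
by rewrite nE; field.
Qed.

Lemma sum_scale_dr_block (R : realType) (p q : nat) (I : Type) (s : seq I)
    (c : I -> R) (A : I -> 'M[R]_q) :
  \sum_(k <- s) c k *: block_mx (0 : 'M[R]_p) 0 0 (A k)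
  = block_mx 0 0 0 (\sum_(k <- s) c k *: A k).
Proof.
elim/big_rec2: _ => [|k x y _ ->]; first by rewrite block_mx0.
by rewrite scale_block_mx add_block_mx !scaler0 !addr0.
Qed.

Lemma special_laplacian_gram (R : realType) (n : nat) : (0 < n)%N -> ~~ odd n ->
  special_laplacian R n = (1 / 2) *: ((sign_vectors R n.-1)^T *m sign_vectors R n.-1).
Proof.
move=> n0 en; rewrite /special_laplacian.
have nR : n%:R - 1 = n.-1%:R :> R by rewrite -[in LHS](prednK n0) -natr1 addrK.
have om : odd n.-1 by lia.
rewrite /sign_vectors tr_row_mx mul_col_row sum_scale_dr_block.
rewrite scalar_mx_block !scale_block_mx opp_block_mx !add_block_mx.
congr block_mx; apply/matrixP => i j.
- rewrite !mxE !ord1 nR (eq_bigr (fun=> 1)) => [|t _]; last first.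
    by rewrite !mxE -expr2 sqrr_sign.
  by rewrite sumr_const card_ord /=; field.
- rewrite !mxE (eq_bigr (fun t : 'I__ =>
     (-1) ^+ j * ((-1) ^+ t * (-1) ^+ (j <= t)%N))) => [|t _]; last first.
    by rewrite !mxE; ring.
  rewrite -mulr_sumr sum_step_alternating (odd_signr _ _ om).
  rewrite (minn_idPl (ltnW (ltn_ord j))).
  (* The sign attached to column [j] squares away, so every border entry is -1 before the factor
     1/2. *)
  have := sqrr_sign R j; rewrite expr2 => jj.
  by rewrite !mulrBr jj; field.
- rewrite !mxE (eq_bigr (fun t : 'I__ =>
     (-1) ^+ i * ((-1) ^+ t * (-1) ^+ (i <= t)%N))) => [|t _]; last first.
    by rewrite !mxE; ring.
  rewrite -mulr_sumr sum_step_alternating (odd_signr _ _ om).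
  rewrite (minn_idPl (ltnW (ltn_ord i))).
  have := sqrr_sign R i; rewrite expr2 => jj.
  by rewrite !mulrBr jj; field.
- rewrite !mxE summxE.
  pose d := ((j + (n.-1 - i)) %% n.-1)%N.
  under eq_bigr => k _ do rewrite !mxE /= -/d.
  have dn : (d < n.-1)%N by rewrite ltn_mod; lia.
  have ij := ltn_ord i; have jj := ltn_ord j.
  (* Below the diagonal the offset wraps around. *)
  have dE : d = if (i <= j)%N then (j - i)%N else (n.-1 - (i - j))%N.
    rewrite /d; case: ifP => ij'; last by rewrite modn_small; lia.
    have -> : (j + (n.-1 - i) = (j - i) + n.-1)%N by lia.
    by rewrite modnDr modn_small //; lia.
  have d0 : (i == j) = (d == 0)%N.
    by rewrite dE -val_eqE /=; case: ifP => ?; lia.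
  rewrite d0 mulr0 oppr0 addr0 sum_circulant_coef //.
  rewrite (eq_bigr (fun t : 'I__ => ((-1) ^+ i * (-1) ^+ j) *
     ((-1) ^+ (i <= t)%N * (-1) ^+ (j <= t)%N))) => [|t _]; last first.
    by rewrite !mxE; ring.
  rewrite -mulr_sumr -exprD nR dE; case: ifP => ij'.
    rewrite sum_step_signs //.
    rewrite (minn_idPl (ltnW jj)) (minn_idPl (ltnW ij)) natrB //.
    rewrite -[(-1) ^+ (j - i)]signr_odd -[(-1) ^+ (i + j)]signr_odd.
    by rewrite oddB // oddD addbC; field.
  have ji : (j <= i)%N by lia.
  (* The smaller index has to come first for [sum_step_signs]. *)
  under eq_bigr => t _ do rewrite mulrC.
  rewrite sum_step_signs //.
  rewrite (minn_idPl (ltnW jj)) (minn_idPl (ltnW ij)).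
  (* Oddness of [n.-1] hides the wrap-around: the sign and the linear factor both change sign. *)
  have -> : (-1) ^+ (n.-1 - (i - j)) = - (-1) ^+ (i + j) :> R.
    rewrite -[LHS]signr_odd -[in RHS]signr_odd.
    have -> : odd (n.-1 - (i - j)) = ~~ odd (i + j) by lia.
    by case: (odd _); rewrite /= ?expr0 ?expr1 ?opprK.
  rewrite !natrB //; last by lia.
  by field.
Qed.

(** The quadratic form at [x] is [a] times the sum of squares of the entries of [G *m x]. *)
Lemma positive_semidefinite_gram (R : realType) (p m : nat) (a : R)
    (G : 'M[R]_(p, m)) :
  0 <= a -> positive_semidefinite (a *: (G^T *m G)).
Proof.
move=> a0; split; first by rewrite linearZ /= trmx_mul trmxK.
move=> x; rewrite -scalemxAr -scalemxAl mxE mulr_ge0 //.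
rewrite mulmxA -trmx_mul -mulmxA mxE sumr_ge0 // => t _.
by rewrite mxE -expr2 sqr_ge0.
Qed.

Theorem theorem3 (R : realType) (n : nat) (hn : (4 <= n)%N) (hn_even : ~~ odd n) :
  positive_semidefinite (special_laplacian R n).
Proof.
rewrite special_laplacian_gram //; last exact: leq_trans hn.
by apply: positive_semidefinite_gram; rewrite divr_ge0 ?ler0n.
Qed.
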